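(* Let $R$ be a ring with a nice topology. If $R$ is Dedekind-finite and (von Neumann) regular, then $R$ is a full exchange ring.
   Context: $R$ is Dedekind-finite if $xy=1$ implies $yx=1$; regular means every $x$ satisfies $x=xyx$ for some $y$. A linear Hausdorff topology on $R$ is a ring topology with a basis $\mathfrak U$ of neighborhoods of $0$ consisting of left ideals, with $\bigcap_{U\in\mathfrak U}U=0$. A family $\{x_i\}_{i\in I}\subseteq R$ is summable to $r$ if for every $U\in\mathfrak U$ there is a finite $F'\subseteq I$ with $\sum_{i\in F}x_i-r\in U$ for all finite $F$ with $F'\subseteq F\subseteq I$ (write $\sum_{i\in I}x_i=r$; the family is then called summable). The topology is nice if it is linear, Hausdorff, and for every summable family $\{x_i\}_{i\in I}$ and every family $\{r_i\}_{i\in I}\subseteq R$ the family $\{r_ix_i\}_{i\in I}$ is summable. For a cardinal $\aleph$, $R$ is an $\aleph$-exchange ring if for every family $\{x_i\}_{i\in I}$ with $|I|\le\aleph$ summable to $1$ there exist pairwise orthogonal idempotents $e_i\in Rx_i$ forming a summable family with $\sum_{i\in I}e_i=1$; $R$ is a full exchange ring if it is an $\aleph$-exchange ring for every cardinal $\aleph$. *)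

(* Defs.v *)
From mathcomp Require Import all_boot all_algebra.
From Stdlib Require List.
Set Implicit Arguments. Unset Strict Implicit. Unset Printing Implicit Defensive.
Import GRing.Theory.
Local Open Scope ring_scope.

Section Defs.
Variable R : pzRingType.

Definition dedekind_finite : Prop :=
  forall x y : R, x * y = 1 -> y * x = 1.

Definition vn_regular : Prop :=
  forall x : R, exists y : R, x = x * y * x.

Definition left_ideal (U : R -> Prop) : Prop :=
  [/\ U 0, (forall a b, U a -> U b -> U (a + b)) & (forall r a, U a -> U (r * a))].

(* B is a family of left ideals forming a basis of neighbourhoods of 0 for
   a ring topology on R (the topology it generates), which is Hausdorff. *)
Definition linear_hausdorff (B : (R -> Prop) -> Prop) : Prop :=
  [/\ (exists U, B U),
      (forall U, B U -> left_ideal U),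
      (forall U V, B U -> B V -> exists W, [/\ B W, forall a, W a -> U a
                                              & forall a, W a -> V a]),
      (* continuity of multiplication: right multiplication by x *)
      (forall U x, B U -> exists V, B V /\ forall a, V a -> U (a * x))
    &
      (forall a, (forall U, B U -> U a) -> a = 0)].

(* {x_i}_{i in I} is summable to r: for every U there is a finite F' with
   sum_{i in F} x_i - r in U for all finite F containing F'.  Finite subsets
   of I are represented by duplicate-free lists. *)
Definition summable_to (B : (R -> Prop) -> Prop) (I : Type) (x : I -> R) (r : R)
  : Prop :=
  forall U, B U -> exists F' : seq I,
    forall F : seq I, List.NoDup F -> List.incl F' F ->
      U ((\sum_(i <- F) x i) - r).

Definition summable (B : (R -> Prop) -> Prop) (I : Type) (x : I -> R) : Prop :=
  exists r, summable_to B x r.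

Definition nice_topology (B : (R -> Prop) -> Prop) : Prop :=
  linear_hausdorff B /\
  forall (I : Type) (x : I -> R) (r : I -> R),
    summable B x -> summable B (fun i => r i * x i).

(* aleph-exchange for the cardinal |I|, quantified over all index types I:
   i.e. aleph-exchange for every cardinal aleph. *)
Definition full_exchange (B : (R -> Prop) -> Prop) : Prop :=
  forall (I : Type) (x : I -> R), summable_to B x 1 ->
    exists e : I -> R,
      [/\ (forall i, e i * e i = e i),
          (forall i j, i <> j -> e i * e j = 0),
          (forall i, exists s, e i = s * x i)
        & summable_to B e 1].

End Defs.

(* Main.v *)
(** Well-order the index set and choose recursively idempotents [e i] in [R x_i]
    with [e j * e i = 0] for [j < i] such that [e j] ([j <= i]) and [x_j]
    ([j <= i]) have the same common right annihilator.  By triangularity this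
    annihilator is the one of the single element [phi = \sum_(j < i) e j], hence
    by regularity of the form [gR] with [g] idempotent; a regular inverse of
    [x_i g] then yields [e i].  In the end [phi = \sum_i e i] has zero right
    annihilator, so it is left invertible by regularity and a unit by Dedekind
    finiteness.  Triangularity again shows that the idempotents [phi^-1 * e i]
    are orthogonal, and they sum to [1]. *)
Require Import Defs.
From mathcomp Require Import all_boot all_algebra.
From mathcomp Require Import boolp wochoice.
From Stdlib Require List.
Set Implicit Arguments. Unset Strict Implicit. Unset Printing Implicit Defensive.
Import GRing.Theory.
Local Open Scope ring_scope.

Lemma exists_wf_total (I : Type) :
  exists lt : I -> I -> Prop, well_founded lt /\
    forall i j, [\/ lt i j, i = j | lt j i].
Proof.
have [R woR] := well_ordering_principle {classic I}.
have chR : wo_chain R predT by move=> A _; exact: woR.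
exists (fun j i => ~~ R i j); split; last first.
  move=> i j; case Rij: (R i j); last by constructor 3.
  case Rji: (R j i); last by constructor 1.
  by constructor 2; apply: (wo_chain_antisymmetric chR) => //; rewrite Rij.
move=> i; apply: contrapT => nAi.
(* A minimal non-accessible [z] is contradictory, since everything strictly below it is
   accessible. *)
have [z [[Az minz] _]] :
    exists! z, minimum_of R (fun k => `[< ~ Acc (fun j i => ~~ R i j) k >]) z.
  by apply: woR; exists i; apply/asboolP.
move/asboolP: Az; apply; constructor => y nRzy.
by apply: contrapT => nAy; rewrite minz // in nRzy; exact/asboolP.
Qed.

(** Each value may depend on all earlier ones; padding with [a0] turns the partial history into a
    total function that [P] can take. *)
Lemma wf_recursive_choice (I A : Type) (lt : I -> I -> Prop) (a0 : A)
    (P : I -> (I -> A) -> A -> Prop) :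
  well_founded lt -> (forall i f, exists a, P i f a) ->
  exists e, forall i, P i (fun j => if pselect (lt j i) then e j else a0) (e i).
Proof.
move=> wf exP.
pose step i f := sval (cid (exP i f)).
pose F i (rec : forall j, lt j i -> A) :=
  step i (fun j => if pselect (lt j i) is left h then rec j h else a0).
exists (Fix wf (fun _ => A) F) => i.
rewrite (Fix_eq wf (fun _ => A) F); last first.
  move=> k f g fg; congr (step k _); apply: funext => j.
  by case: pselect => // h; rewrite fg.
rewrite {2}/F (_ : (fun j => match pselect (lt j i) with left _ => _ | _ => _ end)
  = (fun j => if pselect (lt j i) then Fix wf (fun _ => A) F j else a0)).
  exact: svalP (cid (exP i _)).
by apply: funext => j; case: pselect.
Qed.

Lemma exists_reflexive_inverse (R : pzRingType) (t : R) : vn_regular R ->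
  exists2 y, t * y * t = t & y * t * y = y.
Proof.
move=> reg; have [y tE] := reg t; exists (y * t * y).
  by rewrite !mulrA -!tE.
have ytE : y * t * y * t = y * t by rewrite -!mulrA (mulrA t) -tE.
by rewrite !mulrA !ytE.
Qed.

Lemma exists_idempotent_step (R : pzRingType) (x phi : R) : vn_regular R ->
  exists e, [/\ exists s, e = s * x, e * e = e, phi * e = 0
    & forall r, phi * r = 0 -> e * r = 0 -> x * r = 0].
Proof.
move=> reg; have [z phiE] := reg phi; pose g := 1 - z * phi.
have phig : phi * g = 0 by rewrite mulrBr mulr1 mulrA -phiE subrr.
have gr r : phi * r = 0 -> g * r = r.
  by move=> h; rewrite mulrBl mul1r -mulrA h mulr0 subr0.
have [y xgE yE] := exists_reflexive_inverse (x * g) reg.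
(* Here [g] projects onto the right annihilator of [phi], and [y * (x * g) * y = y] makes this
   product idempotent. *)
exists (g * y * x); split.
- by exists (g * y).
- by rewrite -{3}yE !mulrA.
- by rewrite !mulrA phig !mul0r.
move=> r phir er.
have xgr : x * g * r = x * r by rewrite -mulrA gr.
have xgg : x * g * g = x * g by rewrite -mulrA gr.
(* With [g * r = r] and [g * g = g], [x * r = x * g * y * x * g * r = x * g * (e * r) = 0]. *)
rewrite -xgr -xgE !mulrA -(mulrA _ g r) gr // -[x * g in LHS]xgg.
by rewrite -[RHS](mulr0 (x * g)) -er !mulrA.
Qed.

Section LinearTopology.
Variables (R : pzRingType) (B : (R -> Prop) -> Prop).
Hypothesis linB : linear_hausdorff B.

Let nbh_ideal U : B U -> left_ideal U.
Proof. by case: linB => _ + _ _ _; apply. Qed.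

Lemma nbh_sub U a b : B U -> U a -> U b -> U (a - b).
Proof.
by case/nbh_ideal => _ addU mulU Ua Ub; rewrite -mulN1r; apply/addU/mulU.
Qed.

Lemma summable_to_mulr I (f : I -> R) s c :
  summable_to B f s -> summable_to B (fun i => c * f i) (c * s).
Proof.
move=> sumf U BU; have [F' hF'] := sumf U BU; exists F' => F ndF incF.
by rewrite -mulr_sumr -mulrBr; have [_ _] := nbh_ideal BU; apply; exact: hF'.
Qed.

Lemma summable_to_mull I (f : I -> R) s c :
  summable_to B f s -> summable_to B (fun i => f i * c) (s * c).
Proof.
move=> sumf U BU; case: linB => _ _ _ /(_ U c BU)[V [BV VU]] _.
have [F' hF'] := sumf V BV; exists F' => F ndF incF.
by rewrite -mulr_suml -mulrBl; apply/VU/hF'.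
Qed.

Lemma summable_to_sub I (f g : I -> R) s t :
  summable_to B f s -> summable_to B g t ->
  summable_to B (fun i => f i - g i) (s - t).
Proof.
move=> sumf sumg U BU; have [F hF] := sumf U BU; have [G hG] := sumg U BU.
exists (F ++ G) => H ndH /List.incl_app_inv[incF incG].
have -> : \sum_(i <- H) (f i - g i) - (s - t)
  = (\sum_(i <- H) f i - s) - (\sum_(i <- H) g i - t).
  by rewrite sumrB !opprB addrACA [RHS]addrACA [- s - _]addrC.
by apply: nbh_sub => //; [exact: hF | exact: hG].
Qed.

Lemma summable_to_uniq I (f : I -> R) s t :
  summable_to B f s -> summable_to B f t -> s = t.
Proof.
move=> sums sumt; apply/eqP; rewrite -subr_eq0; apply/eqP.
case: linB => _ _ _ _; apply => U BU.
have [F hF] := sums U BU; have [G hG] := sumt U BU.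
have dec (i j : I) : {i = j} + {i <> j} by exact: pselect.
pose H := List.nodup dec (F ++ G).
have ndH : List.NoDup H by exact: List.NoDup_nodup.
have incH : List.incl (F ++ G) H by move=> i; rewrite List.nodup_In.
have [incF incG] := List.incl_app_inv _ _ incH.
have -> : s - t = (\sum_(i <- H) f i - t) - (\sum_(i <- H) f i - s).
  by rewrite opprB [RHS]addrC addrA subrK.
by apply: nbh_sub => //; [exact: hG | exact: hF].
Qed.

Lemma summable_to_single I (f : I -> R) i :
  (forall j, j <> i -> f j = 0) -> summable_to B f (f i).
Proof.
move=> f0 U BU; exists [:: i] => F ndF incF.
suff -> : \sum_(j <- F) f j = f i by rewrite subrr; case: (nbh_ideal BU).
have {incF} : List.In i F by apply: incF; left.
elim: F ndF => //= j F IH /List.NoDup_cons_iff[njF ndF] [ji | iF]; last first.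
  rewrite big_cons IH // f0 ?add0r // => ji.
  by apply: njF; rewrite ji.
rewrite big_cons ji -[RHS]addr0; congr (_ + _); rewrite {}ji {IH ndF} in njF.
elim: F njF => [|k F IH] /= nF; first by rewrite big_nil.
rewrite big_cons IH ?addr0; last by tauto.
by apply: f0 => ki; apply: nF; left.
Qed.

Lemma summable_to_zero I (f : I -> R) s :
  (forall i, f i = 0) -> summable_to B f s -> s = 0.
Proof.
move=> f0 sumf; apply: summable_to_uniq sumf _ => U BU.
exists [::] => F _ _; rewrite big1 ?subr0 //; first by case: (nbh_ideal BU).
Qed.

Variables (I : Type) (lt : I -> I -> Prop).
Hypotheses (wf : well_founded lt)
           (tri : forall i j, [\/ lt i j, i = j | lt j i]).

(** Multiply the sum by [f i] on the left: terms before [i] vanish by induction, terms after [i] by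
    triangularity, so only [f i * w i] survives. *)
Lemma triangular_sum_eq0 (f w : I -> R) :
  (forall i, f i * f i = f i) -> (forall i j, lt i j -> f i * f j = 0) ->
  summable_to B (fun i => f i * w i) 0 -> forall i, f i * w i = 0.
Proof.
move=> idf orf sum0; apply: (well_founded_ind wf) => i IH.
have := summable_to_mulr (f i) sum0; rewrite mulr0 => sum_i0.
rewrite -[f i in LHS]idf -mulrA; apply: summable_to_uniq sum_i0.
apply: (@summable_to_single _ (fun j => f i * (f j * w j))) => j ji.
case: (tri i j) => [ij | ij | /IH->]; rewrite ?mulr0 //; last by case: ji.
by rewrite mulrA orf ?mul0r.
Qed.

Lemma triangular_annihilator (f : I -> R) phi r :
  (forall i, f i * f i = f i) -> (forall i j, lt i j -> f i * f j = 0) ->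
  summable_to B f phi -> phi * r = 0 -> forall i, f i * r = 0.
Proof.
move=> idf orf sumf phir; apply: (@triangular_sum_eq0 f (fun=> r)) => //.
by rewrite -phir; exact: summable_to_mull.
Qed.

(** Coefficients in a triangular expansion are unique up to the factor [f i]. Since [phi * psi = 1],
    the constant family [psi * f k] and the Kronecker delta [d] both expand [f k]. *)
Lemma triangular_orthogonal (f : I -> R) phi psi :
  (forall i, f i * f i = f i) -> (forall i j, lt i j -> f i * f j = 0) ->
  summable_to B f phi -> phi * psi = 1 ->
  forall i k, f i * psi * f k = if pselect (i = k) then f k else 0.
Proof.
move=> idf orf sumf phipsi i k.
pose d j : R := if pselect (j = k) then 1 else 0.
have sumd : summable_to B (fun j => f j * d j) (f k).
  have -> : f k = f k * d k by rewrite /d; case: pselect => // ?; rewrite mulr1.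
  apply: (@summable_to_single _ (fun j => f j * d j)) => j jk.
  by rewrite /d; case: pselect => // ?; rewrite mulr0.
have := triangular_sum_eq0 (w := fun j => psi * f k - d j) idf orf _ i.
rewrite mulrBr mulrA => h; apply/eqP; rewrite -subr_eq0; apply/eqP.
have -> : (if pselect (i = k) then f k else 0) = f i * d i.
  by rewrite /d; case: pselect => /= [ik | _]; rewrite ?mulr0 // mulr1 ik.
apply: h; have := summable_to_sub (summable_to_mull (psi * f k) sumf) sumd.
rewrite mulrA phipsi mul1r subrr.
by congr summable_to; apply: funext => j; rewrite mulrBr.
Qed.

End LinearTopology.

Lemma exists_triangular_idempotents (R : pzRingType) (B : (R -> Prop) -> Prop)
    (I : Type) (lt : I -> I -> Prop) (x : I -> R) :
  nice_topology B -> vn_regular R -> well_founded lt ->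
  (forall i j, [\/ lt i j, i = j | lt j i]) -> summable B x ->
  exists e : I -> R,
    [/\ forall i, exists s, e i = s * x i, forall i, e i * e i = e i,
        forall i j, lt i j -> e i * e j = 0
      & forall r, (forall i, e i * r = 0) -> forall i, x i * r = 0].
Proof.
move=> [linB nice] reg wf tri sumx.
pose good i phi e := [/\ exists s, e = s * x i, e * e = e, phi * e = 0
  & forall r, phi * r = 0 -> e * r = 0 -> x i * r = 0].
(* The choice must be possible for every [f], so summability is a premise; it is discharged for the
   actual history in [main]. *)
have [] := @wf_recursive_choice _ _ lt 0
    (fun i f a => summable B f -> exists2 phi, summable_to B f phi & good i phi a)
    wf.
  move=> i f; have [[phi sumf] | nsum] := lem (summable B f); last by exists 0.
  by have [a ga] := exists_idempotent_step (x i) phi reg; exists a => _; exists phi.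
move=> e eP; pose below i j := if pselect (lt j i) then e j else 0.
(* Both claims go through one induction: splitting [phi * e i = 0] into [e j * e i = 0] needs
   triangularity of the earlier idempotents. *)
have main i : (exists2 phi, summable_to B (below i) phi & good i phi (e i))
    /\ forall j, lt j i -> e j * e i = 0.
  elim/(well_founded_ind wf): i => i IH.
  have [phi sumphi gi] : exists2 phi, summable_to B (below i) phi & good i phi (e i).
    (* Niceness applies because every term is a left multiple of [x j], with multiplier [0] outside
       the initial segment. *)
    apply: eP; have /choice[s sE] : forall j, exists s, below i j = s * x j.
      move=> j; rewrite /below.
      case: pselect => /= [/IH[[? _ []]] // | _].
      by exists 0; rewrite mul0r.
    by rewrite -/(below i) (funext sE); exact: nice.
  split; first by exists phi.
  case: gi => _ _ phie _ j ji.
  suff : below i j * e i = 0 by rewrite /below; case: pselect.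
  apply: (triangular_annihilator linB wf tri _ _ sumphi phie); rewrite /below.
    move=> k; case: pselect => /= [/IH[[? _ []]] // | _].
    by rewrite mulr0.
  move=> k l kl; case: pselect => /= [_|_]; last by rewrite mul0r.
  by case: pselect => /= [/IH[_] | _]; [exact | rewrite mulr0].
exists e; split.
- by move=> i; have [[? _ []]] := main i.
- by move=> i; have [[? _ []]] := main i.
- by move=> i j ij; have [_] := main j; exact.
move=> r er i; have [[phi sumphi [_ _ _ xr]] _] := main i.
apply: xr => //; apply: (summable_to_zero linB) (summable_to_mull linB r sumphi).
by move=> j; rewrite /below; case: pselect => /= _; rewrite ?mul0r.
Qed.

Theorem theorem2 (R : pzRingType) (B : (R -> Prop) -> Prop) :
  nice_topology B -> dedekind_finite R -> vn_regular R -> full_exchange B.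
Proof.
move=> niceB dedR reg I x sumx; have [linB nice] := niceB.
have [lt [wf tri]] := exists_wf_total I.
have [e [ex ide ore xr]] :=
  exists_triangular_idempotents niceB reg wf tri (ex_intro _ 1 sumx).
have [s sE] := choice ex.
have [phi sumphi] : summable B e.
  by rewrite (funext sE); apply: nice; exists 1.
(* Such an [r] is killed by every [e i], hence by every [x i], hence by their sum [1]. *)
have phi_inj r : phi * r = 0 -> r = 0.
  move=> phir; have er := triangular_annihilator linB wf tri ide ore sumphi phir.
  rewrite -[r]mul1r; apply: (summable_to_zero linB) (summable_to_mull linB r sumx).
  exact: xr.
have [psi phiE] := reg phi.
have psiphi : psi * phi = 1.
  apply/esym/eqP; rewrite -subr_eq0; apply/eqP/phi_inj.
  by rewrite mulrBr mulr1 mulrA -phiE subrr.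
have orth := triangular_orthogonal linB wf tri ide ore sumphi (dedR _ _ psiphi).
(* By [orth], [e i * psi * e k] is [e k] if [i = k] and [0] otherwise, which gives both idempotence
   and orthogonality. *)
exists (fun i => psi * e i); split.
- move=> i; rewrite -mulrA (mulrA (e i)) orth.
  by case: pselect.
- move=> i j ij; rewrite -mulrA (mulrA (e i)) orth.
  by case: pselect => // ?; rewrite mulr0.
- by move=> i; exists (psi * s i); rewrite sE mulrA.
by rewrite -psiphi; exact: summable_to_mulr.
Qed.
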